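(* Let $X=\{x_1,\dots,x_n\}$ be an i.i.d. sample drawn from $f_\theta$. For each $i\in[n]$, let $X_i'$ denote the adjacent data set obtained from $X$ by replacing $x_i$ with an independent copy $x_i'\sim f_\theta$. Assume $\mathbb E_\theta S_\theta(x)=0$, that $\mathcal I(\theta)=\mathbb E_\theta\{S_\theta(x)S_\theta(x)^\top\}$ is finite, and that $\mathbb E_\theta\|M(X)-\theta\|_2^2<\infty$. 1. (Soundness) For each $i\in[n]$, $$\mathbb E\,\mathcal A_\theta(x_i,M(X_i'))=0,\qquad \mathbb E|\mathcal A_\theta(x_i,M(X_i'))|\le \sqrt{\mathbb E\|M(X)-\theta\|_2^2}\,\sqrt{\lambda_{\max}(\mathcal I(\theta))}.$$ 2. (Completeness) Write $f_\theta^{(n)}$ for the joint density of $X$ with respect to a common dominating measure, and assume the family has common support. Suppose $\mathbb E_\theta|M_j(X)|<\infty$ and, for every $j\in[d]$ and every $\theta$, $f_\theta^{(n)}(\mathbf x)$ is differentiable in $\theta_j$ and there are a neighborhood $U$ of $\theta$ and an integrable function $G_j$ such that $$\left|\mathbb E_M\{M_j(\mathbf x)\}\,\partial_{\theta_j}f^{(n)}_{\vartheta}(\mathbf x)\right|\le G_j(\mathbf x)\quad\text{for every }\vartheta\in U,$$ where $\mathbb E_M$ denotes expectation over the internal randomness of $M$ for a fixed input. Then $$\sum_{i\in[n]}\mathbb E\,\mathcal A_\theta(x_i,M(X))=\sum_{j\in[d]}\frac{\partial}{\partial\theta_j}\mathbb E\,M(X)_j .$$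
   Context: $\{f_\theta:\theta\in\Theta\}$, $\Theta\subseteq\mathbb R^d$, is a parametric family of densities on a sample space $\mathcal X$ (with respect to a common dominating measure), differentiable in $\theta$. The score is $S_\theta(x)=\nabla_\theta\log f_\theta(x)$. $M:\mathcal X^n\to\mathbb R^d$ is a (possibly randomized) estimator, whose internal randomness is independent of the data; $M_j$ or $M(X)_j$ is its $j$th coordinate. The score attack is $\mathcal A_\theta(z,M(X))=\langle M(X)-\theta,\,S_\theta(z)\rangle$. Expectations $\mathbb E$ are over the data drawn under $f_\theta$ (including the independent copy) and the randomness of $M$. $[n]=\{1,\dots,n\}$ and $\lambda_{\max}$ is the largest eigenvalue. *)

(* Defs.v *)
From HB Require Import structures.
From mathcomp Require Import all_boot all_order all_algebra.
From mathcomp Require Import all_classical all_reals all_analysis.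

Set Implicit Arguments.
Unset Strict Implicit.
Unset Printing Implicit Defensive.

Import Order.TTheory GRing.Theory Num.Theory.
Import numFieldNormedType.Exports.

Local Open Scope classical_set_scope.
Local Open Scope ring_scope.

Definition tuple_cons (T : Type) (n : nat) (p : T * n.-tuple T) : n.+1.-tuple T :=
  [tuple of p.1 :: p.2].

Lemma measurable_tuple_cons (d : measure_display) (T : measurableType d) n :
  measurable_fun [set: T * n.-tuple T] (@tuple_cons T n).
Proof. exact: measurable_cons. Qed.

Section product_step.
Context (d : measure_display) (T : measurableType d) (R : realType) (n : nat).
Variables (mu : {sigma_finite_measure set T -> \bar R})
  (nu : {sigma_finite_measure set (n.-tuple T) -> \bar R}).

Definition product_step : set (n.+1.-tuple T) -> \bar R :=
  pushforward (mu \x nu)%E (@tuple_cons T n).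

Let product_step0 : product_step set0 = 0%E.
Proof. by rewrite /product_step /pushforward preimage_set0 measure0. Qed.

Let product_step_ge0 A : (0 <= product_step A)%E.
Proof. by rewrite /product_step /pushforward; exact: measure_ge0. Qed.

Let product_step_sigma_additive : semi_sigma_additive product_step.
Proof.
move=> F mF tF mUF; rewrite /product_step /pushforward preimage_bigcup.
apply: measure_semi_sigma_additive.
- by move=> k; rewrite -[X in measurable X]setTI; exact: measurable_tuple_cons.
- apply/trivIsetP => /= i j _ _ ij; rewrite -preimage_setI.
  by move/trivIsetP : tF => /(_ _ _ _ _ ij) ->//; rewrite preimage_set0.
- rewrite -preimage_bigcup -[X in measurable X]setTI.
  exact: measurable_tuple_cons.
Qed.

HB.instance Definition _ := isMeasure.Build _ _ _
  product_step product_step0 product_step_ge0 product_step_sigma_additive.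

Let product_step_sigma_finite : sigma_finite setT product_step.
Proof.
have /sigma_finiteP[F [TF ndF Foo]] := sigma_finiteT mu.
have /sigma_finiteP[G [TG ndG Goo]] := sigma_finiteT nu.
pose g (t : n.+1.-tuple T) : T * n.-tuple T := (thead t, [tuple of behead t]).
have mg : measurable_fun [set: n.+1.-tuple T] g.
  apply/measurable_fun_pairP; split; first exact: measurable_tnth.
  exact: measurable_behead.
have gK : cancel (@tuple_cons T n) g.
  by move=> [x t]; congr pair; apply/val_inj.
exists (fun k => g @^-1` (F k `*` G k)).
  rewrite predeqE => t; split=> // _.
  have [k _ Fk] : (\bigcup_k F k) (thead t) by rewrite -TF.
  have [l _ Gl] : (\bigcup_k G k) [tuple of behead t] by rewrite -TG.
  exists (maxn k l) => //; split => /=.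
  - by move: Fk; exact/subsetPset/ndF/leq_maxl.
  - by move: Gl; exact/subsetPset/ndG/leq_maxr.
move=> k; have [mF Fk] := Foo k; have [mG Gk] := Goo k; split.
  by rewrite -[X in measurable X]setTI; apply: mg => //; exact: measurableX.
rewrite /product_step /pushforward -comp_preimage.
rewrite (_ : g \o _ = id); last by apply/funext => p /=; rewrite gK.
by rewrite preimage_id product_measure1E// lte_mul_pinfty// ge0_fin_numE.
Qed.

HB.instance Definition _ := Measure_isSigmaFinite.Build _ _ _
  product_step product_step_sigma_finite.

End product_step.

(* The n-fold product measure on T^n. It is built by hand because the
   library only has binary products. *)
Fixpoint power_measure (d : measure_display) (T : measurableType d)
    (R : realType) (mu : {sigma_finite_measure set T -> \bar R}) (n : nat) :
    {sigma_finite_measure set (n.-tuple T) -> \bar R} :=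
  match n with
  | 0 => \d_([tuple] : 0.-tuple T)
  | m.+1 => product_step mu (power_measure mu m)
  end.

Section iid_law.
Context (d : measure_display) (T : measurableType d) (R : realType).
Variables (P : probability T R) (n : nat).

Definition iid_law : set (n.-tuple T) -> \bar R := power_measure P n.

HB.instance Definition _ := Measure.on iid_law.

Let iid_law_setT : iid_law setT = 1%E.
Proof.
rewrite /iid_law; elim: n => [|m IH] /=; first by rewrite diracE in_setT.
rewrite /product_step /pushforward preimage_setT -setXTT product_measure1E//.
by rewrite IH mule1; exact: probability_setT.
Qed.

HB.instance Definition _ :=
  Measure_isProbability.Build _ _ _ iid_law iid_law_setT.

End iid_law.
Arguments iid_law {d T R} P n _.

Section linear_algebra.
Context (R : realType) (d : nat).

Definition dotprod (u v : 'rV[R]_d) : R := \sum_(j < d) u ord0 j * v ord0 j.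

Definition norm2 (u : 'rV[R]_d) : R := Num.sqrt (dotprod u u).

(* Real eigenvalues only; meant for symmetric A, where the supremum is
   attained as soon as 0 < d (and it is 0 for d = 0). *)
Definition lambda_max (A : 'M[R]_d) : R := sup [set a : R | eigenvalue A a].

Definition partial (j : 'I_d) (g : 'rV[R]_d -> R) (theta : 'rV[R]_d) : R :=
  'D_(delta_mx ord0 j) g theta.

End linear_algebra.

Section model.
Context (dX : measure_display) (X : measurableType dX) (R : realType) (d : nat).

Definition is_density (mu : {sigma_finite_measure set X -> \bar R})
    (P : probability X R) (g : X -> R) : Prop :=
  [/\ measurable_fun setT g, forall x, 0 <= g x &
      forall A, measurable A -> P A = (\int[mu]_(x in A) (g x)%:E)%E].

(* f is a total function of the parameter; it is a family of densities only
   for parameters in some set Theta, and derivatives in the parameter at a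
   boundary point of Theta are those of this total function. *)
Variable f : 'rV[R]_d -> X -> R.

Definition common_support (Theta : set 'rV[R]_d) : Prop :=
  forall theta theta', Theta theta -> Theta theta' ->
    [set x | 0 < f theta x] = [set x | 0 < f theta' x].

Definition joint_density {n : nat} (theta : 'rV[R]_d) (x : n.-tuple X) : R :=
  \prod_(i < n) f theta (tnth x i).

(* ln is 0 on nonpositive reals, so the score vanishes at z when f is 0 at z
   for all parameters near theta. *)
Definition score (theta : 'rV[R]_d) (z : X) : 'rV[R]_d :=
  \row_(j < d) partial j (fun t => ln (f t z)) theta.

Definition fisher (P : probability X R) (theta : 'rV[R]_d) : 'M[R]_d :=
  \matrix_(j < d, k < d)
    Rintegral P setT (fun x => score theta x ord0 j * score theta x ord0 k).

Definition score_attack (theta : 'rV[R]_d) (z : X) (m : 'rV[R]_d) : R :=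
  dotprod (m - theta) (score theta z).

End model.

Definition replace (X : Type) (n : nat) (x : n.-tuple X) (i : 'I_n) (x' : X) :
    n.-tuple X :=
  [tuple if k == i then x' else tnth x k | k < n].

(* Main.v *)
Require Import Defs.
From HB Require Import structures.
From mathcomp Require Import all_boot all_order all_algebra.
From mathcomp Require Import all_classical all_reals all_analysis.
From mathcomp Require Import measurable_realfun ring lra.

Set Implicit Arguments.
Unset Strict Implicit.
Unset Printing Implicit Defensive.

Import Order.TTheory GRing.Theory Num.Theory.
Import numFieldNormedType.Exports.

Local Open Scope classical_set_scope.
Local Open Scope ring_scope.

(** Soundness.  Exchanging an observation with its independent copy preserves
    the product law, so if [X'] is the data set with [x_i] replaced, the pair
    [(X', x_i)] has the law of [(X, x)] with [x] a fresh draw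
    ([integral_replace]).  The attack thus becomes [<M(X) - theta, S(x)>] with
    [x] independent of [X] and of the seed.  Integrating over [x] first gives
    mean [0], because the score is centred ([integral_cross]), and second moment
    [u I u^T] with [u = M(X) - theta] and [I] the Fisher matrix.  That quadratic
    form is at most [lambda_max I * |u|^2] ([rayleigh_le_lambda_max]), and
    Jensen's inequality turns the second moment into the bound on the mean
    absolute value ([integral_norm_cross_le]).

    Completeness.  Write [m_j(x)] for the mean of [M_j(x)] over the seed and
    [f^n] for the joint density.  Since the score is the gradient of [ln f],
    the sum of the [j]-th scores of the observations times [f^n] equals
    [d_j f^n]; where [f^n] vanishes both sides are [0], as the support does not
    move with the parameter ([partial_joint_density_score]).  Hence the expected
    total attack is the sum over [j] of the integrals of [m_j d_j f^n], the part
    with [theta_j] dropping out because the scores are centred.  On the other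
    hand, [E M_j] is the integral of [m_j f^n] for every parameter in the
    family, and the dominating function allows differentiating under the
    integral sign ([derive_mean]). *)

(** * Quadratic forms and the largest eigenvalue *)

Section rayleigh.
Context (R : realType).

Lemma dotprodDl d (u v w : 'rV[R]_d) : dotprod (u + v) w = dotprod u w + dotprod v w.
Proof. by rewrite -big_split; apply: eq_bigr => j _; rewrite mxE mulrDl. Qed.

Lemma dotprodZl d a (u w : 'rV[R]_d) : dotprod (a *: u) w = a * dotprod u w.
Proof. by rewrite mulr_sumr; apply: eq_bigr => j _; rewrite mxE mulrA. Qed.

Lemma dotprodC d (u v : 'rV[R]_d) : dotprod u v = dotprod v u.
Proof. by apply: eq_bigr => j _; rewrite mulrC. Qed.

Lemma dotprodDr d (u v w : 'rV[R]_d) : dotprod w (u + v) = dotprod w u + dotprod w v.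
Proof. by rewrite dotprodC dotprodDl !(dotprodC w). Qed.

Lemma dotprodZr d a (u w : 'rV[R]_d) : dotprod w (a *: u) = a * dotprod w u.
Proof. by rewrite dotprodC dotprodZl dotprodC. Qed.

Lemma dotprod0l d (u : 'rV[R]_d) : dotprod 0 u = 0.
Proof. by rewrite /dotprod big1// => j _; rewrite mxE mul0r. Qed.

Lemma dotprod_ge0 d (u : 'rV[R]_d) : 0 <= dotprod u u.
Proof. by apply: sumr_ge0 => j _; rewrite -expr2 sqr_ge0. Qed.

Lemma dotprod_eq0 d (u : 'rV[R]_d) : (dotprod u u == 0) = (u == 0).
Proof.
apply/eqP/eqP => [u0|->]; last first.
  exact: dotprod0l.
apply/rowP => j; rewrite mxE; apply/eqP; rewrite -sqrf_eq0 expr2.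
have /psumr_eq0P-> // : forall k, true -> 0 <= u ord0 k * u ord0 k.
by move=> k _; rewrite -expr2 sqr_ge0.
Qed.

Lemma dotprod_mulmx_sym d (A : 'M[R]_d) (u v : 'rV[R]_d) :
  A^T = A -> dotprod (u *m A) v = dotprod u (v *m A).
Proof.
move=> sA; rewrite /dotprod.
under eq_bigr do rewrite mxE mulr_suml.
rewrite exchange_big; apply: eq_bigr => k _ /=; rewrite mxE mulr_sumr.
apply: eq_bigr => j _; rewrite -mulrA (mulrC (A k j)).
by congr (_ * (_ * _)); rewrite -{1}sA mxE.
Qed.

(** If [w = u B] were nonzero, moving from [u] in the direction [- w] would make
    the form negative: along [u + t w] it is [2 t |w|^2 + t^2 (w B w^T)], whose
    linear term dominates for small [t]. *)
Lemma psd_null_form d (B : 'M[R]_d) (u : 'rV[R]_d) : B^T = B ->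
  (forall v, 0 <= dotprod (v *m B) v) -> dotprod (u *m B) u = 0 -> u *m B = 0.
Proof.
move=> sB B0 uB0; apply/eqP; rewrite -dotprod_eq0.
set v := u *m B; set b := dotprod v v; set c := dotprod (v *m B) v.
have c0 : 0 <= c := B0 v.
have b0 : 0 <= b := dotprod_ge0 v.
have key t : 0 <= 2 * t * b + t ^+ 2 * c.
  have := B0 (u + t *: v).
  rewrite mulmxDl dotprodDl -scalemxAl dotprodZl !dotprodDr !dotprodZr.
  rewrite uB0 (dotprod_mulmx_sym v u sB) -/v -/c -/b.
  by congr (_ <= _); ring.
rewrite eq_le b0 andbT leNgt; apply/negP => bp.
(* [c + 1] instead of [c] keeps the denominator positive when [c = 0]. *)
have := key (- (b / (c + 1))).
have c1 : 0 < c + 1 by rewrite ltr_wpDl.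
suff : 2 * - (b / (c + 1)) * b + (- (b / (c + 1))) ^+ 2 * c < 0
  by rewrite ltNge => /negP.
have -> : 2 * - (b / (c + 1)) * b + (- (b / (c + 1))) ^+ 2 * c =
  - (b ^+ 2 * (c + 2) / (c + 1) ^+ 2) by field; rewrite gt_eqF.
rewrite oppr_lt0 divr_gt0 ?mulr_gt0 ?exprn_gt0//.
by rewrite ltr_wpDl.
Qed.

Lemma continuous_coord d (j : 'I_d) : continuous (fun u : 'rV[R]_d => u ord0 j).
Proof. exact: coord_continuous. Qed.

Lemma continuous_bigsum (T : topologicalType) I (r : seq I) (F : I -> T -> R) :
  (forall i, continuous (F i)) -> continuous (fun x => \sum_(i <- r) F i x).
Proof.
move=> cF x; apply: cvg_big => [|i _]; first exact: add_continuous.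
exact: cF.
Qed.

Lemma continuous_mulr (T : topologicalType) (f g : T -> R) :
  continuous f -> continuous g -> continuous (fun x => f x * g x).
Proof. by move=> cf cg x; apply: cvgM; [exact: cf|exact: cg]. Qed.

Lemma continuous_dotprod d (A : 'M[R]_d) :
  continuous (fun u : 'rV[R]_d => dotprod (u *m A) u).
Proof.
have -> : (fun u : 'rV[R]_d => dotprod (u *m A) u) =
    (fun u => \sum_j \sum_i u ord0 i * A i j * u ord0 j).
  by apply/funext => u; apply: eq_bigr => j _; rewrite mxE mulr_suml.
apply: continuous_bigsum => j; apply: continuous_bigsum => i.
apply: continuous_mulr; last exact: continuous_coord.
apply: continuous_mulr; first exact: continuous_coord.
by move=> u; exact: (@cst_continuous _ _ (A i j)).
Qed.

Lemma compact_sphere d : compact [set u : 'rV[R]_d | dotprod u u = 1].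
Proof.
apply: bounded_closed_compact.
  exists 1; split; first exact: num_real.
  move=> M M1 u /= u1; rewrite (le_trans _ (ltW M1))//.
  rewrite [leLHS]/Num.norm /= mx_normrE; apply/bigmax_leP; split => // -[i j] _ /=.
  rewrite (ord1 i) -(@ler_pXn2r _ 2%N)// ?nnegrE// real_normK ?num_real//.
  rewrite expr1n -u1 /dotprod (bigD1 j)//= expr2 lerDl sumr_ge0// => k _.
  by rewrite -expr2 sqr_ge0.
have -> : [set u : 'rV[R]_d | dotprod u u = 1] =
    (fun u : 'rV[R]_d => dotprod (u *m 1%:M) u) @^-1` [set 1].
  by apply/seteqP; split => u /=; rewrite mulmx1.
apply: closed_comp => [u _|]; first exact: continuous_dotprod.
exact: closed_eq.
Qed.

(** The Rayleigh quotient attains its maximum [L] on the compact unit sphere,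
    say at [c].  Then [L - A] is positive semidefinite and its form vanishes at
    [c], so [c A = L c].  Thus [L] is an eigenvalue, and it bounds all the
    others. *)
Lemma rayleigh_le_lambda_max d (A : 'M[R]_d) (u : 'rV[R]_d) : A^T = A ->
  dotprod (u *m A) u <= lambda_max A * dotprod u u.
Proof.
move=> sA.
have [->|u0] := eqVneq u 0; first by rewrite mul0mx !dotprod0l mulr0.
have norm1 (v : 'rV[R]_d) : v != 0 ->
    dotprod ((Num.sqrt (dotprod v v))^-1 *: v)
      ((Num.sqrt (dotprod v v))^-1 *: v) = 1.
  move=> v0; rewrite dotprodZl dotprodZr mulrA -invfM -expr2.
  by rewrite sqr_sqrtr ?dotprod_ge0// mulVf// dotprod_eq0.
have [c cS cmax] := EVT_max_rV (ex_intro _ _ (norm1 _ u0)) (@compact_sphere d)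
  (continuous_subspaceT (@continuous_dotprod d A)).
rewrite inE /= in cS; set L := dotprod (c *m A) c in cmax.
have ray (v : 'rV[R]_d) : dotprod (v *m A) v <= L * dotprod v v.
  have [->|v0] := eqVneq v 0; first by rewrite mul0mx !dotprod0l mulr0.
  have vv : 0 < dotprod v v by rewrite lt_neqAle eq_sym dotprod_eq0 v0 dotprod_ge0.
  have := cmax _ (mem_set (norm1 _ v0)).
  rewrite -scalemxAl dotprodZl dotprodZr mulrA -invfM -expr2.
  by rewrite sqr_sqrtr ?dotprod_ge0// ler_pdivrMl// mulrC.
suff LL : L <= lambda_max A.
  by rewrite (le_trans (ray u))// ler_wpM2r// dotprod_ge0.
apply: ub_le_sup => /=.
- exists L => a /eigenvalueP[v va v0].
  have vv : 0 < dotprod v v by rewrite lt_neqAle eq_sym dotprod_eq0 v0 dotprod_ge0.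
  by have := ray v; rewrite va dotprodZl ler_pM2r.
- pose B := L%:M - A.
  have BE v w : dotprod (v *m B) w = L * dotprod v w - dotprod (v *m A) w.
    by rewrite mulmxBr mul_mx_scalar dotprodDl dotprodZl -scaleN1r dotprodZl mulN1r.
  have cB : c *m B = 0.
    apply: psd_null_form.
    - by rewrite linearB /= tr_scalar_mx sA.
    - by move=> v; rewrite BE subr_ge0.
    - by rewrite BE cS mulr1 subrr.
  apply/eigenvalueP; exists c.
    by move/eqP: cB; rewrite mulmxBr mul_mx_scalar subr_eq0 => /eqP.
  by rewrite -dotprod_eq0 cS oner_eq0.
Qed.

End rayleigh.

(** * Integration against the product of identical factors *)

Section product_integrals.
Context (d : measure_display) (T : measurableType d) (R : realType).
Local Open Scope ereal_scope.

Lemma ge0_integral_product_step n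
    (mu : {sigma_finite_measure set T -> \bar R})
    (nu : {sigma_finite_measure set (n.-tuple T) -> \bar R})
    (h : n.+1.-tuple T -> \bar R) :
  measurable_fun [set: n.+1.-tuple T] h -> (forall t, 0 <= h t) ->
  \int[product_step mu nu]_t h t =
    \int[mu]_x \int[nu]_t h (tuple_cons (x, t)).
Proof.
move=> mh h0.
have mtc := @measurable_tuple_cons d T n.
transitivity (\int[pushforward (mu \x nu) (@tuple_cons T n)]_t h t) => //.
rewrite (ge0_integral_pushforward mtc)//.
rewrite preimage_setT fubini_tonelli1//; first exact: measurableT_comp mtc.
by move=> x; exact: h0.
Qed.

Lemma ge0_integral_iid_lawS (P : probability T R) n
    (h : n.+1.-tuple T -> \bar R) :
  measurable_fun [set: n.+1.-tuple T] h -> (forall t, 0 <= h t) ->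
  \int[iid_law P n.+1]_t h t =
    \int[P]_x \int[iid_law P n]_t h (tuple_cons (x, t)).
Proof. exact: ge0_integral_product_step. Qed.

End product_integrals.

Section replacement.
Context (d : measure_display) (T : measurableType d) (R : realType).
Local Open Scope ereal_scope.

Lemma measurable_replace n (i : 'I_n) :
  measurable_fun [set: n.-tuple T * T] (fun p => replace p.1 i p.2).
Proof.
apply/measurable_fun_tnthP => k.
rewrite (_ : _ \o _ = fun p : n.-tuple T * T => if k == i then p.2 else tnth p.1 k).
  case: (k == i); first exact: measurable_snd.
  exact: ((measurable_fun_tnthP _).1 measurable_fst k).
by apply/funext => p /=; rewrite tnth_mktuple.
Qed.

Lemma replace_cons0 n (y x : T) (t : n.-tuple T) :
  replace (tuple_cons (y, t)) ord0 x = tuple_cons (x, t).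
Proof.
apply: eq_from_tnth => k; rewrite tnth_mktuple.
by case: (unliftP ord0 k) => [j ->|->]; rewrite ?tnthS ?tnth0.
Qed.

Lemma replace_consS n (y x : T) (t : n.-tuple T) (i : 'I_n) :
  replace (tuple_cons (y, t)) (lift ord0 i) x = tuple_cons (y, replace t i x).
Proof.
apply: eq_from_tnth => k; rewrite tnth_mktuple.
case: (unliftP ord0 k) => [j ->|->]; rewrite ?tnthS ?tnth0//.
by rewrite tnth_mktuple (inj_eq lift_inj).
Qed.

Lemma measurable_swap_replace n (i : 'I_n) :
  measurable_fun [set: n.-tuple T * T]
    (fun p => (replace p.1 i p.2, tnth p.1 i)).
Proof.
apply/measurable_fun_pairP; split; first exact: measurable_replace.
exact: ((measurable_fun_tnthP _).1 measurable_fst i).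
Qed.

(** By induction on [n], peeling off the first observation.  If that one is
    replaced, the claim is the symmetry of [P x P], once the remaining
    observations are integrated out; otherwise it is the induction hypothesis at
    a fixed first observation. *)
Lemma iterated_integral_replace (P : probability T R) n (i : 'I_n)
    (h : n.-tuple T * T -> \bar R) :
  measurable_fun [set: n.-tuple T * T] h -> (forall p, 0 <= h p) ->
  \int[iid_law P n]_x \int[P]_y h (replace x i y, tnth x i) =
  \int[iid_law P n]_x \int[P]_y h (x, y).
Proof.
elim: n i h => [|n IH] i h mh h0; first by case: i.
have mc : measurable_fun [set: (T * n.-tuple T) * T]
    (fun q => (tuple_cons q.1, q.2)).
  apply/measurable_fun_pairP; split; last exact: measurable_snd.
  exact: measurableT_comp (@measurable_tuple_cons d T n) measurable_fst.
have mh' : measurable_fun [set: (T * n.-tuple T) * T]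
    (fun q => h (tuple_cons q.1, q.2)) by exact: measurableT_comp mh mc.
have ms := measurable_swap_replace i.
have mx (x : T) : measurable_fun [set: n.-tuple T * T]
    (fun p : n.-tuple T * T => ((x, p.1), p.2)).
  apply/measurable_fun_pairP; split; last exact: measurable_snd.
  apply/measurable_fun_pairP; split; first exact: (measurable_cst x).
  exact: measurable_fst.
have mhx (x : T) := measurableT_comp mh' (mx x).
have my (x : T) : measurable_fun [set: n.-tuple T * T]
    (fun p : n.-tuple T * T => ((p.2, p.1), x)).
  apply/measurable_fun_pairP; split; last exact: (measurable_cst x).
  apply/measurable_fun_pairP; split; first exact: measurable_snd.
  exact: measurable_fst.
have mhy (x : T) := measurableT_comp mh' (my x).
have mz : measurable_fun [set: (T * T) * n.-tuple T]
    (fun q : (T * T) * n.-tuple T => ((q.1.1, q.2), q.1.2)).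
  apply/measurable_fun_pairP; split.
    apply/measurable_fun_pairP; split; last exact: measurable_snd.
    exact: measurableT_comp measurable_fst measurable_fst.
  exact: measurableT_comp measurable_snd measurable_fst.
have mhz := measurableT_comp mh' mz.
rewrite [LHS]ge0_integral_iid_lawS; last 2 first.
- apply: (measurable_fun_fubini_tonelli_F (h \o
    (fun p : n.+1.-tuple T * T => (replace p.1 i p.2, tnth p.1 i)))).
    exact: measurableT_comp mh ms.
  by move=> p; exact: h0.
- by move=> t; apply: integral_ge0 => y _; exact: h0.
rewrite [RHS]ge0_integral_iid_lawS; last 2 first.
- exact: (measurable_fun_fubini_tonelli_F h).
- by move=> t; apply: integral_ge0 => y _; exact: h0.
have [j ->|->] := unliftP ord0 i.
  apply: eq_integral => x _.
  transitivity (\int[iid_law P n]_t \int[P]_y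
      h (tuple_cons (x, replace t j y), tnth t j)).
    apply: eq_integral => t _; apply: eq_integral => y _.
    by rewrite replace_consS tnthS.
  by apply: (IH j (fun p => h (tuple_cons (x, p.1), p.2))); first exact: mhx.
pose K (p : T * T) := \int[iid_law P n]_t h (tuple_cons (p.1, t), p.2).
have mK : measurable_fun [set: T * T] K.
  apply: (measurable_fun_fubini_tonelli_F
    (fun q : (T * T) * n.-tuple T => h (tuple_cons (q.1.1, q.2), q.1.2))).
    exact: mhz.
  by move=> q; exact: h0.
have K0 p : 0 <= K p by apply: integral_ge0 => t _; exact: h0.
transitivity (\int[P]_x \int[P]_y K (y, x)).
  apply: eq_integral => x _.
  transitivity (\int[iid_law P n]_t \int[P]_y h (tuple_cons (y, t), x)).
    apply: eq_integral => t _; apply: eq_integral => y _.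
    by rewrite replace_cons0 tnth0.
  apply: (fubini_tonelli (fun p => h (tuple_cons (p.2, p.1), x))).
    exact: mhy.
  by move=> q; exact: h0.
rewrite -(fubini_tonelli K)//; apply: eq_integral => x _; apply: esym.
apply: (fubini_tonelli (fun p => h (tuple_cons (x, p.1), p.2))).
  exact: mhx.
by move=> q; exact: h0.
Qed.

End replacement.

Section density.
Context (d : measure_display) (T : measurableType d) (R : realType).
Local Open Scope ereal_scope.

(** The density agrees almost everywhere with the Radon-Nikodym derivative of
    [P], to which the change of variables formula applies. *)
Lemma ge0_integral_density (mu : {sigma_finite_measure set T -> \bar R})
    (P : probability T R) (g : T -> R) (h : T -> \bar R) :
  is_density mu P g -> measurable_fun [set: T] h -> (forall x, 0 <= h x) ->
  \int[P]_x h x = \int[mu]_x (h x * (g x)%:E).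
Proof.
move=> [mg g0 Pg] mh h0.
have mEg : measurable_fun [set: T] (EFin \o g) by exact/measurable_EFinP.
have Pmu : P `<< mu.
  apply/null_content_dominatesP => A mA muA; rewrite Pg//.
  by apply: null_set_integral => //; exact: measurable_funTS.
pose r := Radon_Nikodym_SigmaFinite.f P mu.
have r0 := Radon_Nikodym_SigmaFinite.f_ge0 Pmu.
have ri := Radon_Nikodym_SigmaFinite.f_integrable Pmu.
have mr := measurable_int _ ri.
rewrite -(Radon_Nikodym_SigmaFinite.change_of_variables Pmu h0 measurableT mh).
apply: ge0_ae_eq_integral => //.
- exact: emeasurable_funM.
- exact: emeasurable_funM.
- by move=> x _; exact: mule_ge0.
- by move=> x _; rewrite mule_ge0// lee_fin.
have : ae_eq mu setT r (EFin \o g).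
  apply: integral_ae_eq => // E _ mE.
  by rewrite -Pg// -Radon_Nikodym_SigmaFinite.f_integral.
by apply: filterS => x /(_ I) rx _; congr (_ * _).
Qed.

Lemma measurable_prod_tnth n (g : T -> R) : measurable_fun [set: T] g ->
  measurable_fun [set: n.-tuple T] (fun x => \prod_(i < n) g (tnth x i))%R.
Proof.
move=> mg; apply: measurable_prod => i _.
exact: measurableT_comp mg (@measurable_tnth _ _ _ i).
Qed.

Lemma prod_tuple_cons n (g : T -> R) y (t : n.-tuple T) :
  (\prod_(i < n.+1) g (tnth (tuple_cons (y, t)) i) =
   g y * \prod_(i < n) g (tnth t i))%R.
Proof.
by rewrite big_ord_recl tnth0; congr (_ * _)%R; apply: eq_bigr => i _; rewrite tnthS.
Qed.

Lemma ge0_integral_iid_density (mu : {sigma_finite_measure set T -> \bar R})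
    (P : probability T R) (g : T -> R) n (h : n.-tuple T -> \bar R) :
  is_density mu P g -> measurable_fun [set: n.-tuple T] h ->
  (forall x, 0 <= h x) ->
  \int[iid_law P n]_x h x =
    \int[power_measure mu n]_x (h x * (\prod_(i < n) g (tnth x i))%:E).
Proof.
move=> dg; have [mg g0 _] := dg.
elim: n h => [|n IH] h mh h0.
  apply: eq_integral => x _.
  by rewrite big_ord0 mule1.
have mtc := @measurable_tuple_cons d T n.
have mhc := measurableT_comp mh mtc.
have mgn k := @measurable_prod_tnth k g mg.
have gn0 k (x : k.-tuple T) : (0 <= \prod_(i < k) g (tnth x i))%R.
  by apply: prodr_ge0.
have mhg : measurable_fun [set: T * n.-tuple T]
    (fun p => h (tuple_cons p) * (\prod_(i < n) g (tnth p.2 i))%:E).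
  apply: emeasurable_funM => //; apply/measurable_EFinP.
  exact: measurableT_comp (mgn n) measurable_snd.
rewrite ge0_integral_iid_lawS// (ge0_integral_density dg); last 2 first.
- apply: (measurable_fun_fubini_tonelli_F (h \o @tuple_cons T n)) => [|p].
    exact: mhc.
  exact: h0.
- by move=> x; apply: integral_ge0 => t _; exact: h0.
rewrite [RHS]ge0_integral_product_step; last 2 first.
- apply: emeasurable_funM => //; apply/measurable_EFinP; exact: mgn.
- by move=> t; rewrite mule_ge0// lee_fin.
apply: eq_integral => x _.
rewrite muleC (IH (fun t => h (tuple_cons (x, t)))); last 2 first.
- exact: (measurable_fun_pair2 x mhc).
- by move=> t.
rewrite -ge0_integralZl//; last 3 first.
- exact: (measurable_fun_pair2 x mhg).
- by move=> t _; rewrite mule_ge0// lee_fin.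
- by rewrite lee_fin.
by apply: eq_integral => t _; rewrite prod_tuple_cons EFinM muleCA.
Qed.

Lemma integral_iid_density (mu : {sigma_finite_measure set T -> \bar R})
    (P : probability T R) (g : T -> R) n (h : n.-tuple T -> R) :
  is_density mu P g -> measurable_fun [set: n.-tuple T] h ->
  \int[iid_law P n]_x (h x)%:E =
    \int[power_measure mu n]_x (h x * \prod_(i < n) g (tnth x i))%:E.
Proof.
move=> dg mh; have [mg g0 _] := dg.
have mEh : measurable_fun [set: n.-tuple T] (EFin \o h) by exact/measurable_EFinP.
rewrite [LHS]integralE [RHS]integralE; congr (_ - _).
- rewrite (ge0_integral_iid_density dg)//; last exact: measurable_funepos.
  apply: eq_integral => x _; rewrite !funeposE -!EFin_max -EFinM.
  by rewrite mulrC maxr_pMr ?prodr_ge0// mulr0 mulrC.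
- rewrite (ge0_integral_iid_density dg)//; last exact: measurable_funeneg.
  apply: eq_integral => x _; rewrite !funenegE -!EFinN -!EFin_max -EFinM.
  by rewrite mulrC maxr_pMr ?prodr_ge0// mulr0 mulrN mulrC.
Qed.

Lemma integrable_iid_density (mu : {sigma_finite_measure set T -> \bar R})
    (P : probability T R) (g : T -> R) n (h : n.-tuple T -> R) :
  is_density mu P g -> measurable_fun [set: n.-tuple T] h ->
  (iid_law P n).-integrable setT (EFin \o h) <->
  (power_measure mu n).-integrable setT
    (EFin \o (fun x => h x * \prod_(i < n) g (tnth x i))%R).
Proof.
move=> dg mh; have [mg g0 _] := dg.
have mh' : measurable_fun [set: n.-tuple T]
    (EFin \o (fun x => h x * \prod_(i < n) g (tnth x i))%R).
  by apply/measurable_EFinP/measurable_funM => //; exact: measurable_prod_tnth.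
have mEh : measurable_fun [set: n.-tuple T] (EFin \o h) by exact/measurable_EFinP.
suff E : \int[iid_law P n]_x `|(h x)%:E| =
    \int[power_measure mu n]_x `|(h x * \prod_(i < n) g (tnth x i))%:E|.
  by split => /integrableP[_ hoo]; apply/integrableP; split => //; move: hoo; rewrite /= E.
rewrite (ge0_integral_iid_density dg)//; last exact: measurableT_comp.
apply: eq_integral => x _; rewrite EFinM abseM.
by rewrite (gee0_abs (x := (\prod_(i < n) g (tnth x i))%:E))// lee_fin prodr_ge0.
Qed.

End density.

(** * Exchanging an observation with its independent copy *)

Section transfer.
Local Open Scope ereal_scope.

Lemma integral_probability_cst (d : measure_display) (T : measurableType d)
  (R : realType) (P : probability T R) (c : \bar R) : \int[P]_x c = c.
Proof.
have /= -> := @integral_cst _ _ _ P setT measurableT c.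
by rewrite [X in _ * X]probability_setT mule1.
Qed.

(** An integral is the difference of the integrals of the positive and negative
    parts, so equality on nonnegative functions is enough. *)
Lemma integral_transfer (d1 d2 : measure_display) (Z : measurableType d1)
    (Y : measurableType d2) (R : realType) (m1 : {measure set Z -> \bar R})
    (m2 : {measure set Y -> \bar R}) (phi : Z -> Y) (h : Y -> \bar R) :
  (forall g : Y -> \bar R, measurable_fun [set: Y] g -> (forall y, 0 <= g y) ->
     \int[m1]_z g (phi z) = \int[m2]_y g y) ->
  measurable_fun [set: Y] h ->
  \int[m1]_z h (phi z) = \int[m2]_y h y.
Proof.
move=> ge0E mh; rewrite [LHS]integralE [RHS]integralE; congr (_ - _).
- rewrite -ge0E//; last exact: measurable_funepos.
  by apply: eq_integral => z _; rewrite !funeposE.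
- rewrite -ge0E//; last exact: measurable_funeneg.
  by apply: eq_integral => z _; rewrite !funenegE.
Qed.

Context (d : measure_display) (T : measurableType d) (R : realType)
  (dW : measure_display) (W : measurableType dW).

(** Stated for an arbitrary [phi] that preserves [N x P]: it also moves the
    independent seed next to the first component, ready for Fubini against the
    fresh draw. *)
Lemma integral_exchange_copy (dZ : measure_display) (Z : measurableType dZ)
    (N : probability Z R) (P : probability T R) (Q : probability W R)
    (phi : Z * T -> Z * T) (h : (Z * W) * T -> \bar R) :
  measurable_fun [set: Z * T] phi ->
  (forall g : Z * T -> \bar R, measurable_fun [set: Z * T] g ->
     (forall p, 0 <= g p) ->
     \int[N]_x \int[P]_y g (phi (x, y)) = \int[N]_x \int[P]_y g (x, y)) ->
  measurable_fun [set: (Z * W) * T] h ->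
  \int[N \x P \x Q]_p h (((phi p.1).1, p.2), (phi p.1).2) =
  \int[(N \x Q) \x P]_q h q.
Proof.
move=> mphi phiE; apply: integral_transfer => {}h mh h0.
pose H (p : Z * T) := \int[Q]_w h ((p.1, w), p.2).
have ma : measurable_fun [set: (Z * T) * W]
    (fun p : (Z * T) * W => ((p.1.1, p.2), p.1.2)).
  apply/measurable_fun_pairP; split.
    apply/measurable_fun_pairP; split; last exact: measurable_snd.
    exact: measurableT_comp measurable_fst measurable_fst.
  exact: measurableT_comp measurable_snd measurable_fst.
have mha := measurableT_comp mh ma.
have mH : measurable_fun [set: Z * T] H.
  apply: (measurable_fun_fubini_tonelli_F
    (fun p : (Z * T) * W => h ((p.1.1, p.2), p.1.2))).
    exact: mha.
  by move=> p; exact: h0.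
have H0 p : 0 <= H p by apply: integral_ge0 => w _; exact: h0.
have mst : measurable_fun [set: (Z * T) * W]
   (fun p : (Z * T) * W => (phi p.1, p.2)).
  apply/measurable_fun_pairP; split; last exact: measurable_snd.
  exact: measurableT_comp mphi measurable_fst.
transitivity (\int[N \x P]_p H (phi p)).
  apply: (@fubini_tonelli1 _ _ _ _ _ (N \x P : probability (Z * T)%type R) Q
    (fun p => h (((phi p.1).1, p.2), (phi p.1).2))).
    exact: measurableT_comp mha mst.
  by move=> p; exact: h0.
transitivity (\int[N]_x \int[P]_y H (phi (x, y))).
  apply: (@fubini_tonelli1 _ _ _ _ _ N P (H \o phi)).
    exact: measurableT_comp mH mphi.
  by move=> p; exact: H0.
rewrite [LHS](phiE H mH H0).
transitivity (\int[N \x Q]_p \int[P]_y h (p, y)); last first.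
  exact/esym/(@fubini_tonelli1 _ _ _ _ _ (N \x Q : probability (Z * W)%type R) P h).
transitivity (\int[N]_x \int[Q]_w \int[P]_y h ((x, w), y)); last first.
  apply/esym/(@fubini_tonelli1 _ _ _ _ _ N Q (fun p => \int[P]_y h (p, y))).
    exact: (measurable_fun_fubini_tonelli_F h).
  by move=> p; apply: integral_ge0 => y _; exact: h0.
apply: eq_integral => x _.
have mx : measurable_fun [set: T * W] (fun q : T * W => ((x, q.2), q.1)).
  apply/measurable_fun_pairP; split; last exact: measurable_fst.
  apply/measurable_fun_pairP; split; first exact: (measurable_cst x).
  exact: measurable_snd.
apply: (fubini_tonelli (fun q : T * W => h ((x, q.2), q.1))).
  exact: measurableT_comp mh mx.
by move=> q; exact: h0.
Qed.

(** The observation that was replaced is independent of the new data set and of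
    the seed. *)
Lemma integral_replace (P : probability T R) (Q : probability W R)
    n (i : 'I_n) (h : (n.-tuple T * W) * T -> \bar R) :
  measurable_fun [set: (n.-tuple T * W) * T] h ->
  \int[iid_law P n \x P \x Q]_p h ((replace p.1.1 i p.1.2, p.2), tnth p.1.1 i) =
  \int[(iid_law P n \x Q) \x P]_q h q.
Proof.
apply: (@integral_exchange_copy _ _ (iid_law P n) P Q
  (fun p => (replace p.1 i p.2, tnth p.1 i)) h).
  exact: measurable_swap_replace.
by move=> g mg g0; exact: iterated_integral_replace.
Qed.

(** The integral over an extra copy is added and exchanged with the [i]-th
    observation. *)
Lemma integral_tnth (P : probability T R) n (i : 'I_n) (h : T -> \bar R) :
  measurable_fun [set: T] h ->
  \int[iid_law P n]_x h (tnth x i) = \int[P]_y h y.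
Proof.
apply: integral_transfer => {}h mh h0.
have mh2 : measurable_fun [set: n.-tuple T * T] (h \o snd).
  exact: measurableT_comp mh measurable_snd.
transitivity (\int[iid_law P n]_x \int[P]_y h (tnth x i)).
  apply: eq_integral => x _.
  by rewrite integral_probability_cst.
rewrite (iterated_integral_replace P i mh2) => [|p]; last exact: h0.
exact: (@integral_probability_cst _ _ _ (iid_law P n) (\int[P]_y h y)).
Qed.

Lemma ge0_integral_fst (P : probability T R) (Q : probability W R) (h : T -> \bar R) :
  measurable_fun [set: T] h -> (forall x, 0 <= h x) ->
  \int[P \x Q]_p h p.1 = \int[P]_x h x.
Proof.
move=> mh h0.
rewrite fubini_tonelli1//; last exact: measurableT_comp mh measurable_fst.
apply: eq_integral => x _.
exact: (integral_probability_cst Q (h x)).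
Qed.

Lemma integral_fst (P : probability T R) (Q : probability W R) (h : T -> \bar R) :
  measurable_fun [set: T] h -> \int[P \x Q]_p h p.1 = \int[P]_x h x.
Proof.
by apply: integral_transfer => g; exact: ge0_integral_fst.
Qed.

End transfer.

(** * Moments *)

Section moments.
Context (d : measure_display) (T : measurableType d) (R : realType).

Lemma integrable_lincomb (mu : {measure set T -> \bar R}) (I : Type)
    (r : seq I) (c : I -> R) (g : I -> T -> R) :
  (forall i, mu.-integrable setT (EFin \o g i)) ->
  mu.-integrable setT (EFin \o (fun x => \sum_(i <- r) c i * g i x)).
Proof.
move=> ig.
have -> : EFin \o (fun x => \sum_(i <- r) c i * g i x) =
    (fun x => \sum_(i <- r) ((c i)%:E * (g i x)%:E)%E)%E.
  by apply/funext => x /=; rewrite -sumEFin; apply: eq_bigr => i _; rewrite EFinM.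
by apply: integrable_sum => // i _; apply: integrableZl => //; exact: ig.
Qed.

Lemma integral_lincomb (mu : {measure set T -> \bar R}) (I : Type)
    (r : seq I) (c : I -> R) (g : I -> T -> R) :
  (forall i, mu.-integrable setT (EFin \o g i)) ->
  (\int[mu]_x (\sum_(i <- r) c i * g i x)%:E =
  (\sum_(i <- r) c i * Rintegral mu setT (g i))%:E)%E.
Proof.
move=> ig; under eq_integral do rewrite -sumEFin.
rewrite integral_sum// => [|i]; last first.
  by under eq_fun do rewrite EFinM; apply: integrableZl => //; exact: ig.
rewrite -sumEFin; apply: eq_bigr => i _.
under eq_integral do rewrite EFinM.
by rewrite (integralZl measurableT (ig i)) EFinM fineK//; exact: integrable_fin_num (ig i).
Qed.

Lemma integrable_of_sqr (P : probability T R) (Y : T -> R) :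
  measurable_fun setT Y -> (\int[P]_x ((Y x) ^+ 2)%:E < +oo)%E ->
  P.-integrable setT (EFin \o Y).
Proof.
move=> mY Y2.
have i2 : P.-integrable setT (EFin \o (fun x => 1 + Y x ^+ 2)).
  under [_ \o _]eq_fun do rewrite /= EFinD.
  apply: integrableD => //; first exact: finite_measure_integrable_cst.
  apply/integrableP; split.
    by apply/measurable_EFinP; exact: measurable_funX.
  by under eq_integral do rewrite gee0_abs ?lee_fin ?sqr_ge0//.
apply: le_integrable i2 => //; first exact/measurable_EFinP.
move=> x _ /=; rewrite lee_fin [leRHS]ger0_norm ?addr_ge0 ?sqr_ge0//.
by have := sqr_ge0 (Y x - 1); have := sqr_ge0 (Y x + 1); case: (ger0P (Y x)); nra.
Qed.

Lemma integrable_mul_of_sqr (mu : {measure set T -> \bar R}) (Y Z : T -> R) :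
  measurable_fun setT Y -> measurable_fun setT Z ->
  (\int[mu]_x ((Y x) ^+ 2)%:E < +oo)%E -> (\int[mu]_x ((Z x) ^+ 2)%:E < +oo)%E ->
  mu.-integrable setT (EFin \o (fun x => Y x * Z x)).
Proof.
move=> mY mZ Y2 Z2.
have sq (V : T -> R) : measurable_fun setT V -> (\int[mu]_x ((V x) ^+ 2)%:E < +oo)%E ->
    mu.-integrable setT (EFin \o (fun x => V x ^+ 2)).
  move=> mV V2; apply/integrableP; split.
    by apply/measurable_EFinP; exact: measurable_funX.
  by under eq_integral do rewrite gee0_abs ?lee_fin ?sqr_ge0//.
have i2 : mu.-integrable setT (EFin \o (fun x => Y x ^+ 2 + Z x ^+ 2)).
  under [_ \o _]eq_fun do rewrite /= EFinD.
  by apply: integrableD => //; exact: sq.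
apply: le_integrable i2 => //; first exact/measurable_EFinP/measurable_funM.
move=> x _ /=; rewrite lee_fin [leRHS]ger0_norm ?addr_ge0 ?sqr_ge0//.
have := sqr_ge0 (Y x - Z x); have := sqr_ge0 (Y x + Z x).
by move=> ? ?; rewrite ler_norml; apply/andP; split; nra.
Qed.

(** With [a] the mean of [|Y|], integrating [2 a |Y| <= a^2 + Y^2] gives
    [a^2 <= b]. *)
Lemma integral_norm_le_sqrt (P : probability T R) (Y : T -> R) (b : R) :
  measurable_fun setT Y -> (\int[P]_x ((Y x) ^+ 2)%:E <= b%:E)%E ->
  (\int[P]_x `|Y x|%:E <= (Num.sqrt b)%:E)%E.
Proof.
move=> mY Yb.
have iY := integrable_of_sqr mY (le_lt_trans Yb (ltry _)).
have iaY : P.-integrable setT (EFin \o (fun x => `|Y x|)) by exact: integrable_abse iY.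
set a := (\int[P]_x _)%E.
have afin : a \is a fin_num by exact: integrable_fin_num.
have a0 : 0 <= fine a by apply: fine_ge0; apply: integral_ge0 => x _; rewrite lee_fin.
have iY2 : P.-integrable setT (EFin \o (fun x => Y x ^+ 2)).
  apply/integrableP; split.
    by apply/measurable_EFinP; exact: measurable_funX.
  under eq_integral do rewrite gee0_abs ?lee_fin ?sqr_ge0//.
  exact: le_lt_trans Yb (ltry _).
rewrite -(fineK afin) lee_fin -(ler_pXn2r (n := 2))// ?nnegrE ?sqrtr_ge0//.
have b0 : 0 <= b.
  rewrite -lee_fin (le_trans _ Yb)//; apply: integral_ge0 => x _.
  by rewrite lee_fin sqr_ge0.
rewrite sqr_sqrtr//.
have : (\int[P]_x (2 * fine a * `|Y x|)%:E <= \int[P]_x ((fine a) ^+ 2 + Y x ^+ 2)%:E)%E.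
  apply: ge0_le_integral => //.
  - by move=> x _; rewrite lee_fin mulr_ge0// mulr_ge0.
  - apply/measurable_EFinP; apply: measurable_funM => //.
    exact: measurableT_comp.
  - by apply/measurable_EFinP; apply: measurable_funD => //; exact: measurable_funX.
  - move=> x _; rewrite lee_fin -(real_normK (num_real (Y x))).
    have := sqr_ge0 (fine a - `|Y x|); nra.
under eq_integral do rewrite EFinM.
rewrite integralZl// -/a -[in X in (X <= _)%E -> _](fineK afin).
under [in X in (_ <= X)%E -> _]eq_integral do rewrite EFinD.
rewrite integralD//; last exact: finite_measure_integrable_cst.
rewrite integral_probability_cst -EFinM => H.
have : ((2 * fine a * fine a)%:E <= (fine a ^+ 2)%:E + b%:E)%E.
  by rewrite (le_trans H)// leeD2l.
rewrite -EFinD lee_fin; nra.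
Qed.

End moments.

(** * The attack on a point independent of the estimate *)

(** Here [u] stands for the error of the estimator and [s] for the score of a
    draw independent of it; [A] below is then the Fisher matrix. *)
Section independent_score.
Context (dZ dT : measure_display) (Z : measurableType dZ)
  (T : measurableType dT) (R : realType) (d : nat).
Variables (N : probability Z R) (P : probability T R).
Variables (u : Z -> 'rV[R]_d) (s : T -> 'rV[R]_d).
Hypothesis mu : forall j, measurable_fun [set: Z] (fun z => u z ord0 j).
Hypothesis is1 : forall j, P.-integrable setT (fun x => (s x ord0 j)%:E).
Hypothesis s0 : forall j, (\int[P]_x (s x ord0 j)%:E = 0)%E.
Hypothesis is2 : forall j k,
  P.-integrable setT (fun x => (s x ord0 j * s x ord0 k)%:E).

Let A : 'M[R]_d :=
  \matrix_(j, k) Rintegral P setT (fun x => s x ord0 j * s x ord0 k).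

Lemma integral_sqr_dotprod (c : 'rV[R]_d) :
  (\int[P]_x ((dotprod c (s x)) ^+ 2)%:E = (dotprod (c *m A) c)%:E)%E.
Proof.
pose C (p : 'I_d * 'I_d) := c ord0 p.1 * c ord0 p.2.
transitivity (\int[P]_x
    (\sum_p C p * (s x ord0 p.1 * s x ord0 p.2))%:E)%E.
  apply: eq_integral => x _; congr EFin.
  rewrite expr2 /dotprod mulr_suml.
  under eq_bigr do rewrite mulr_sumr.
  by rewrite pair_big; apply: eq_bigr => p _; rewrite /C /=; ring.
rewrite (integral_lincomb _ _
  (g := fun p x => s x ord0 p.1 * s x ord0 p.2)) => [|p]; last exact: is2.
congr EFin; rewrite /dotprod.
under [RHS]eq_bigr do rewrite mxE mulr_suml.
rewrite exchange_big pair_big /=; apply: eq_bigr => p _.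
by rewrite /C mxE; ring.
Qed.

Lemma gram_sym : A^T = A.
Proof.
apply/matrixP => j k; rewrite !mxE; apply: eq_Rintegral => x _.
by rewrite mulrC.
Qed.

Lemma integral_dotprod (c : 'rV[R]_d) :
  (\int[P]_x (dotprod c (s x))%:E = 0)%E.
Proof.
rewrite (integral_lincomb _ _ (g := fun j x => s x ord0 j)) => [|p];
  last exact: is1.
by rewrite big1// => j _; rewrite /Rintegral s0 mulr0.
Qed.

Lemma measurable_cross :
  measurable_fun [set: Z * T] (fun q : Z * T => dotprod (u q.1) (s q.2)).
Proof.
apply: measurable_sum => j; apply: measurable_funM.
  exact: measurableT_comp (mu j) measurable_fst.
have /measurable_EFinP msj := measurable_int _ (is1 j).
exact: measurableT_comp msj measurable_snd.
Qed.

Lemma measurable_norm_sqr : measurable_fun [set: Z] (fun z => dotprod (u z) (u z)).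
Proof. by apply: measurable_sum => j; apply: measurable_funM. Qed.

(** The maximum with [0] spares a proof that [lambda_max A] is nonnegative, and
    the square root taken later does not see it. *)
Lemma cross_second_moment_le :
  (\int[N \x P]_q ((dotprod (u q.1) (s q.2)) ^+ 2)%:E <=
   (Num.max (lambda_max A) 0)%:E * \int[N]_z (dotprod (u z) (u z))%:E)%E.
Proof.
rewrite fubini_tonelli1 => [||q]; last 2 first.
- by apply/measurable_EFinP; apply: measurable_funX; exact: measurable_cross.
- by rewrite lee_fin sqr_ge0.
rewrite -ge0_integralZl//; last 3 first.
- by apply/measurable_EFinP; exact: measurable_norm_sqr.
- by move=> z _; rewrite lee_fin dotprod_ge0.
- by rewrite lee_fin le_max lexx orbT.
rewrite /fubini_F /=; under eq_integral do rewrite integral_sqr_dotprod.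
apply: ge0_le_integral => //.
- move=> z _; rewrite -integral_sqr_dotprod; apply: integral_ge0 => x _.
  by rewrite lee_fin sqr_ge0.
- apply/measurable_EFinP; apply: measurable_sum => j; apply: measurable_funM => //.
  under eq_fun do rewrite mxE.
  by apply: measurable_sum => k; apply: measurable_funM.
- apply/measurable_EFinP; apply: measurable_funM => //; exact: measurable_norm_sqr.
- move=> z _; rewrite -EFinM lee_fin.
  rewrite (le_trans (rayleigh_le_lambda_max _ gram_sym))//.
  by rewrite ler_wpM2r ?dotprod_ge0// le_max lexx.
Qed.

Hypothesis u2 : (\int[N]_z (dotprod (u z) (u z))%:E < +oo)%E.

Let r := (\int[N]_z (dotprod (u z) (u z))%:E)%E.

Let r_fin : r \is a fin_num.
Proof.
by rewrite ge0_fin_numE//; apply: integral_ge0 => z _; rewrite lee_fin dotprod_ge0.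
Qed.

Lemma integral_norm_cross_le :
  (\int[N \x P]_q `|dotprod (u q.1) (s q.2)|%:E <=
   (Num.sqrt (fine r) * Num.sqrt (lambda_max A))%:E)%E.
Proof.
have := cross_second_moment_le; rewrite -/r -(fineK r_fin) -EFinM => H.
apply: le_trans (integral_norm_le_sqrt measurable_cross H) _.
rewrite lee_fin sqrtrM ?le_max ?lexx ?orbT// mulrC ler_wpM2l ?sqrtr_ge0//.
by have [l0|l0] := lerP 0 (lambda_max A); rewrite ?sqrtr0 ?sqrtr_ge0.
Qed.

Lemma integral_cross :
  (\int[N \x P]_q (dotprod (u q.1) (s q.2))%:E = 0)%E.
Proof.
have := cross_second_moment_le; rewrite -/r -(fineK r_fin) -EFinM => H.
have i1 := integrable_of_sqr measurable_cross (le_lt_trans H (ltry _)).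
rewrite -(integral12_prod_meas1 i1).
apply: integral0_eq => z _; exact: (integral_dotprod (u z)).
Qed.

End independent_score.

(** * The score as a logarithmic derivative *)

(** Directional derivatives are derivatives along a line, which gives access to
    the calculus of functions of one real variable. *)
Section score_calculus.
Context (R : realType) (V : normedModType R).

Lemma line_quotient (g : V -> R) (a v : V) (s : R) :
  (fun h : R => h^-1 *: (g (a + (h *: (1 : R^o) + s) *: v) - g (a + s *: v))) =
  (fun h : R => h^-1 *: (g (h *: v + (a + s *: v)) - g (a + s *: v))).
Proof.
apply/funext => h; congr (_ *: (g _ - _)).
by rewrite [h *: 1]mulr1 scalerDl addrCA.
Qed.

Lemma derivable_line (g : V -> R) (a v : V) (s : R) :
  derivable (fun t : R^o => g (a + t *: v)) s 1 <-> derivable g (a + s *: v) v.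
Proof. by rewrite /derivable line_quotient. Qed.

Lemma derive_line (g : V -> R) (a v : V) (s : R) :
  'D_1 (fun t : R^o => g (a + t *: v)) s = 'D_v g (a + s *: v).
Proof. by rewrite /derive line_quotient. Qed.

Lemma derive_ln_comp (g : V -> R) (a v : V) : 0 < g a -> derivable g a v ->
  'D_v (fun x => ln (g x)) a = 'D_v g a / g a.
Proof.
move=> g0 dg.
have a0 : a + (0 : R) *: v = a by rewrite scale0r addr0.
rewrite -[in LHS]a0 -derive_line.
have dl : is_derive (0 : R^o) 1 (fun t : R^o => g (a + t *: v)) ('D_v g a).
  apply: DeriveDef; first by apply/derivable_line; rewrite a0.
  by rewrite derive_line a0.
have dln : is_derive (g (a + (0 : R) *: v) : R^o) 1 (@ln R) (g a)^-1.
  by rewrite a0; exact: is_derive1_ln.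
have /= := @is_derive1_comp _ _ _ _ _ _ dln dl.
by move=> /@derive_val; rewrite /comp => ->; rewrite mulrC.
Qed.

(** The product rule for factors given by their logarithmic derivatives, which
    add up. *)
Lemma is_derive_prod_log (I : Type) (r : seq I) (F : I -> V -> R) (L : I -> R)
    (a v : V) :
  (forall i, is_derive a v (F i) (L i * F i a)) ->
  is_derive a v (fun x => \prod_(i <- r) F i x)
    ((\sum_(i <- r) L i) * \prod_(i <- r) F i a).
Proof.
move=> dF; elim: r => [|i r IH].
  rewrite !big_nil mul0r; under eq_fun do rewrite big_nil.
  exact: is_derive_cst.
rewrite !big_cons; under eq_fun do rewrite big_cons.
apply: is_derive_eq.
by rewrite /GRing.scale /=; ring.
Qed.

End score_calculus.

Section joint_score.
Context (dX : measure_display) (X : measurableType dX) (R : realType) (d : nat).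
Variables (f : 'rV[R]_d -> X -> R).

Lemma partial_joint_density n (theta : 'rV[R]_d) (x : n.-tuple X) (j : 'I_d) :
  (forall i, 0 < f theta (tnth x i)) ->
  (forall i, derivable (f ^~ (tnth x i)) theta (delta_mx ord0 j)) ->
  partial j (joint_density f ^~ x) theta =
  (\sum_i score f theta (tnth x i) ord0 j) * joint_density f theta x.
Proof.
move=> f0 df; apply: derive_val.
apply: is_derive_prod_log => i.
apply: DeriveDef => //.
by rewrite /score mxE /partial derive_ln_comp// divfK// gt_eqF.
Qed.

End joint_score.

Section joint_support.
Context (dX : measure_display) (X : measurableType dX) (R : realType) (d : nat).
Variables (f : 'rV[R]_d -> X -> R) (Theta : set 'rV[R]_d).
Hypothesis f_ge0 : forall t x, Theta t -> 0 <= f t x.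
Hypothesis f_diff : forall t x, Theta t -> differentiable (f ^~ x) t.
Hypothesis f_supp : common_support f Theta.

(** If some observation has density [0] at [theta], common support makes the
    joint density vanish at all parameters near [theta], and both sides are [0].
    This is where [theta] has to be an interior point. *)
Lemma partial_joint_density_score n (theta : 'rV[R]_d) (x : n.-tuple X)
    (j : 'I_d) :
  Theta° theta ->
  partial j (joint_density f ^~ x) theta =
  (\sum_i score f theta (tnth x i) ord0 j) * joint_density f theta x.
Proof.
move=> thetaI; have thetaT := interior_subset thetaI.
have [pos|/existsNP[i /negP]] := pselect (forall i, 0 < f theta (tnth x i)).
  apply: partial_joint_density => // i.
  exact/diff_derivable/f_diff.
rewrite -leNgt => fi0.
have zero t : Theta t -> joint_density f t x = 0.
  move=> tT; rewrite /joint_density (bigD1 i)//=.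
  suff -> : f t (tnth x i) = 0 by rewrite mul0r.
  apply/eqP; rewrite eq_le f_ge0// andbT leNgt; apply/negP => ft0.
  have : [set z | 0 < f t z] (tnth x i) by [].
  by rewrite (f_supp tT thetaT) /= ltNge fi0.
rewrite (zero _ thetaT) mulr0 /partial.
rewrite (@near_eq_derive _ _ _ _ (cst 0)) ?derive_cst//.
by apply: filterS thetaI => t /zero.
Qed.

End joint_support.

(** * Differentiating the mean of the estimator *)

Section conditional_mean.
Context (dZ dW : measure_display) (Z : measurableType dZ) (W : measurableType dW)
  (R : realType) (N : probability Z R) (Q : probability W R).
Variable Y : Z * W -> R.
Hypothesis iY : (N \x Q)%E.-integrable setT (EFin \o Y).

Let m (z : Z) : R := Rintegral Q setT (fun w => Y (z, w)).

Lemma measurable_seed_mean : measurable_fun setT m.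
Proof.
have := measurable_fubini_F iY.
by move=> mF; exact: measurableT_comp (@fine_measurable R setT measurableT) mF.
Qed.

(** Conditioning on the data: for almost every [z], [Y (z, .)] is integrable, and
    there the factor [S z] can be taken out of the inner integral. *)
Lemma integral_seed_mean (S : Z -> R) : measurable_fun setT S ->
  (N \x Q)%E.-integrable setT (EFin \o (fun p => S p.1 * Y p)) ->
  N.-integrable setT (EFin \o (fun z => S z * m z)) /\
  (\int[N \x Q]_p (S p.1 * Y p)%:E = \int[N]_z (S z * m z)%:E)%E.
Proof.
move=> mS iSY.
have mSm : measurable_fun setT (EFin \o (fun z => S z * m z)).
  by apply/measurable_EFinP/measurable_funM => //; exact: measurable_seed_mean.
have iF := integrable_fubini_F iSY.
have E : ae_eq N setT (fubini_F Q (EFin \o (fun p => S p.1 * Y p)))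
    (EFin \o (fun z => S z * m z)).
  apply: filterS (ae_integrable1 iY) => z iYz _.
  rewrite /fubini_F /=; under eq_integral do rewrite EFinM.
  rewrite (integralZl measurableT iYz) EFinM fineK//.
  exact: (integrable_fin_num measurableT iYz).
split.
  apply/integrableP; split => //; have /integrableP[mF] := iF.
  rewrite (ae_eq_integral (fun z => `|(S z * m z)%:E|)%E)//.
  - exact: measurableT_comp.
  - exact: measurableT_comp.
  - by apply: filterS E => z /(_ I) + _ => ->.
rewrite -(integral12_prod_meas1 iSY); apply: ae_eq_integral => //.
exact: measurable_int iF.
Qed.

End conditional_mean.


Section estimator_mean.
Context (dX : measure_display) (X : measurableType dX) (R : realType)
  (mu : {sigma_finite_measure set X -> \bar R})
  (dW : measure_display) (W : measurableType dW) (Q : probability W R)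
  (n : nat) (Y : n.-tuple X * W -> R).

Let m (x : n.-tuple X) : R := Rintegral Q setT (fun w => Y (x, w)).

Lemma integral_estimator_density (P : probability X R) (g : X -> R)
    (S : n.-tuple X -> R) :
  is_density mu P g -> measurable_fun setT S ->
  (iid_law P n \x Q)%E.-integrable setT (EFin \o Y) ->
  (iid_law P n \x Q)%E.-integrable setT (EFin \o (fun p => S p.1 * Y p)) ->
  (power_measure mu n).-integrable setT
    (EFin \o (fun x => S x * m x * \prod_(i < n) g (tnth x i))) /\
  (\int[iid_law P n \x Q]_p (S p.1 * Y p)%:E =
   \int[power_measure mu n]_x (S x * m x * \prod_(i < n) g (tnth x i))%:E)%E.
Proof.
move=> dg mS iY iSY; have [i E] := integral_seed_mean iY mS iSY.
have mSm : measurable_fun setT (fun x => S x * m x).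
  by apply: measurable_funM => //; exact: measurable_seed_mean iY.
split; first exact: (integrable_iid_density dg mSm).1 i.
by rewrite E (integral_iid_density dg mSm).
Qed.

End estimator_mean.

Section differentiation.
Context (dX : measure_display) (X : measurableType dX) (R : realType) (d : nat)
  (mu : {sigma_finite_measure set X -> \bar R})
  (Theta : set 'rV[R]_d) (f : 'rV[R]_d -> X -> R)
  (P : 'rV[R]_d -> probability X R)
  (f_density : forall t, Theta t -> is_density mu (P t) (f t))
  (dW : measure_display) (W : measurableType dW) (Q : probability W R)
  (n : nat) (Y : n.-tuple X * W -> R) (j : 'I_d).
Hypothesis iY : forall t, Theta t ->
  (iid_law (P t) n \x Q)%E.-integrable setT (EFin \o Y).
Hypothesis joint_derivable : forall t (x : n.-tuple X), Theta t ->
  derivable (joint_density f ^~ x) t (delta_mx ord0 j).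

Let m (x : n.-tuple X) : R := Rintegral Q setT (fun w => Y (x, w)).
Let mean t := fine (\int[iid_law (P t) n \x Q]_p (Y p)%:E)%E.
Let g t := Rintegral (power_measure mu n) setT
  (fun x => m x * joint_density f t x).

Lemma mean_density t : Theta t ->
  (power_measure mu n).-integrable setT
    (EFin \o (fun x => m x * joint_density f t x)) /\ mean t = g t.
Proof.
move=> tT.
have eqm : (fun x => cst 1 x * m x * \prod_(i < n) f t (tnth x i)) =
    (fun x => m x * joint_density f t x) by apply/funext => x; rewrite /= mul1r.
have eqY : (fun p => cst 1 p.1 * Y p) = Y by apply/funext => p; rewrite /= mul1r.
have := @integral_estimator_density _ _ _ mu _ _ Q n Y (P t) (f t) (cst 1)
  (f_density tT) (measurable_cst _) (iY tT).
rewrite -/m eqm eqY => /(_ (iY tT))[i E]; split => //.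
rewrite /mean /g /Rintegral; congr fine.
transitivity (\int[iid_law (P t) n \x Q]_p (cst 1 p.1 * Y p)%:E)%E.
  by apply: eq_integral => p _; rewrite /= mul1r.
by rewrite E; apply: eq_integral => x _; rewrite /= mul1r.
Qed.

(** Near [theta], [mean] is the integral [g] of [m f^n].  Along the segment
    [theta + s e_j], with [s] so small that the parameter stays in the domain of
    the bound, the derivative of the integrand is dominated by [G]. *)
Lemma derive_mean (theta : 'rV[R]_d) (U : set 'rV[R]_d) (G : n.-tuple X -> R) :
  Theta° theta -> nbhs theta U ->
  (power_measure mu n).-integrable setT (EFin \o G) ->
  (forall (x : n.-tuple X) s, U s -> Theta s ->
     `|m x * partial j (joint_density f ^~ x) s| <= G x) ->
  derivable mean theta (delta_mx ord0 j) /\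
  partial j mean theta = Rintegral (power_measure mu n) setT
    (fun x => m x * partial j (joint_density f ^~ x) theta).
Proof.
move=> thetaI nU iG GP; have thetaT := interior_subset thetaI.
pose e : 'rV[R]_d := delta_mx ord0 j.
have [eps eps0 epsP] : exists2 eps : R, 0 < eps &
    forall s : R, s \in `]-eps, eps[ -> U (theta + s *: e) /\ Theta (theta + s *: e).
  have cl : (fun s : R => theta + s *: e) s @[s --> (0 : R)] --> theta.
    rewrite -[X in _ --> X]addr0 -[X in _ + X](scale0r e).
    by apply: cvgD; [exact: cvg_cst|apply: cvgZr_tmp; exact: cvg_id].
  have : \forall s \near (0 : R), (U `&` Theta) (theta + s *: e).
    exact: cl (filterI nU thetaI).
  move=> /nbhs_ballP[eps /= eps0 epsP].
  exists eps => // s; rewrite in_itv /= => sI; apply: epsP.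
  by rewrite /ball /= sub0r normrN ltr_norml.
pose F (s : R) (x : n.-tuple X) := m x * joint_density f (theta + s *: e) x.
have I0 : (`]-eps, eps[%classic : set R) 0 by rewrite /= in_itv /= oppr_lt0 eps0.
have intF s : (`]-eps, eps[%classic : set R) s ->
    (power_measure mu n).-integrable setT (EFin \o F s).
  by move=> /epsP[_ /mean_density[]].
have dF s x : (`]-eps, eps[%classic : set R) s ->
    is_derive (s : R^o) 1 (F ^~ x)
      (m x * partial j (joint_density f ^~ x) (theta + s *: e)).
  move=> /epsP[_ sT].
  have dj : is_derive (s : R^o) 1 (fun s => joint_density f (theta + s *: e) x)
      (partial j (joint_density f ^~ x) (theta + s *: e)).
    apply: DeriveDef.
      exact/(@derivable_line R _ (joint_density f ^~ x))/joint_derivable.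
    exact: (@derive_line R _ (joint_density f ^~ x)).
  exact: (is_deriveZ (m x) dj).
have dF1 s x : (`]-eps, eps[%classic : set R) s -> True -> derivable (F ^~ x) s 1.
  by move=> /(dF s x) h _; exact: ex_derive.
have partialF s x : (`]-eps, eps[%classic : set R) s ->
    partial1of2 F s x = m x * partial j (joint_density f ^~ x) (theta + s *: e).
  by move=> /(dF s x) h; rewrite partial1of2E; exact: derive_val.
have G0 x : 0 <= G x by exact: le_trans (GP x _ (nbhs_singleton nU) thetaT).
have FG s x : (`]-eps, eps[%classic : set R) s -> True -> `|partial1of2 F s x| <= G x.
  by move=> sI _; rewrite partialF//; have [? ?] := epsP _ sI; exact: GP.
have der := derivable_under_integral measurableT I0 intF dF1 G0 iG FG.
have val := differentiation_under_integral measurableT I0 intF dF1 G0 iG FG.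
have th0 : theta + (0 : R) *: e = theta by rewrite scale0r addr0.
have dg : derivable g theta e by rewrite -th0; exact/derivable_line.
have vg : 'D_e g theta = Rintegral (power_measure mu n) setT
    (fun x => m x * partial j (joint_density f ^~ x) theta).
  rewrite -[in LHS]th0 -derive_line -derive1E [LHS]val.
  by apply: eq_Rintegral => x _; rewrite partialF// th0.
have ng : \forall t \near theta, g t = mean t.
  by apply: filterS thetaI => t /mean_density[_ ->].
split; first exact: near_eq_derivable dg.
by rewrite -vg; apply: near_eq_derive; apply: filterS ng => t ->.
Qed.

End differentiation.

(** * Soundness and completeness of the score attack *)

Theorem theorem2p1
  (R : realType) (d n : nat)
  (dX : measure_display) (X : measurableType dX)
  (mu : {sigma_finite_measure set X -> \bar R})
  (Theta : set 'rV[R]_d)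
  (f : 'rV[R]_d -> X -> R)
  (P : 'rV[R]_d -> probability X R)
  (f_density : forall t, Theta t -> is_density mu (P t) (f t))
  (f_differentiable : forall t x, Theta t -> differentiable (f ^~ x) t)
  (dW : measure_display) (W : measurableType dW) (Q : probability W R)
  (M : n.-tuple X -> W -> 'rV[R]_d)
  (M_measurable : forall j : 'I_d,
     measurable_fun setT (fun p : n.-tuple X * W => M p.1 p.2 ord0 j))
  (theta : 'rV[R]_d) (theta_in : Theta theta)
  (score_mean0 : forall j : 'I_d,
     (P theta).-integrable setT (fun x => (score f theta x ord0 j)%:E) /\
     ('E_(P theta)[fun x => score f theta x ord0 j] = 0)%E)
  (fisher_finite : forall j k : 'I_d,
     (P theta).-integrable setT
       (fun x => (score f theta x ord0 j * score f theta x ord0 k)%:E))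
  (risk_finite :
     ('E_(iid_law (P theta) n \x Q)
        [fun p => (norm2 (M p.1 p.2 - theta) ^+ 2)%R] < +oo)%E) :
  (* p.1.1 is the sample, p.1.2 the independent copy, p.2 the seed of M *)
  (forall i : 'I_n,
     ('E_(iid_law (P theta) n \x P theta \x Q)
        [fun p => score_attack f theta (tnth p.1.1 i)
                    (M (replace p.1.1 i p.1.2) p.2)] = 0)%E /\
     ('E_(iid_law (P theta) n \x P theta \x Q)
        [fun p => `|score_attack f theta (tnth p.1.1 i)
                      (M (replace p.1.1 i p.1.2) p.2)|%R]
      <= (Num.sqrt (fine 'E_(iid_law (P theta) n \x Q)
                       [fun p => (norm2 (M p.1 p.2 - theta) ^+ 2)%R])
          * Num.sqrt (lambda_max (fisher f (P theta) theta)))%:E)%E)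
  /\
  (common_support f Theta ->
   (forall (t : 'rV[R]_d) (j : 'I_d), Theta t ->
      ('E_(iid_law (P t) n \x Q)
         [fun p => `|M p.1 p.2 ord0 j|%R] < +oo)%E) ->
   (forall (j : 'I_d) (t : 'rV[R]_d), Theta t ->
      (forall x : n.-tuple X,
         derivable (joint_density f ^~ x) t (delta_mx ord0 j)) /\
      exists (U : set 'rV[R]_d) (G : n.-tuple X -> R),
        [/\ nbhs t U,
            (power_measure mu n).-integrable setT (EFin \o G) &
            forall (x : n.-tuple X) (s : 'rV[R]_d), U s -> Theta s ->
              `| Rintegral Q setT (fun w => M x w ord0 j)
                 * partial j (joint_density f ^~ x) s | <= G x]) ->
   Theta° theta ->
   (forall j : 'I_d,
      derivable (fun t : 'rV[R]_d =>
                   fine ('E_(iid_law (P t) n \x Q)[fun p => M p.1 p.2 ord0 j])%E)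
        theta (delta_mx ord0 j)) /\
   (\sum_(i < n) 'E_(iid_law (P theta) n \x Q)
      [fun p => score_attack f theta (tnth p.1 i) (M p.1 p.2)]
    = (\sum_(j < d)
         partial j
           (fun t : 'rV[R]_d =>
              fine ('E_(iid_law (P t) n \x Q)[fun p => M p.1 p.2 ord0 j])%E)
           theta)%:E)%E).
Proof.
pose N : probability _ R := (iid_law (P theta) n \x Q)%E.
pose u (z : n.-tuple X * W) := M z.1 z.2 - theta.
pose s := score f theta.
have mu_ j : measurable_fun [set: n.-tuple X * W] (fun z => u z ord0 j).
  have -> : (fun z => u z ord0 j) = (fun z => M z.1 z.2 ord0 j - theta ord0 j).
    by apply/funext => z; rewrite /u !mxE.
  by apply: measurable_funB => //; exact: measurable_cst.
have is1 j : (P theta).-integrable setT (fun x => (s x ord0 j)%:E).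
  by have [] := score_mean0 j.
have s0 j : (\int[P theta]_x (s x ord0 j)%:E = 0)%E.
  by have [_] := score_mean0 j; rewrite unlock.
have riskE : ('E_(iid_law (P theta) n \x Q)
    [fun p => (norm2 (M p.1 p.2 - theta) ^+ 2)%R] =
    \int[N]_z (dotprod (u z) (u z))%:E)%E.
  rewrite unlock; apply: eq_integral => z _.
  by rewrite sqr_sqrtr// dotprod_ge0.
have u2 : (\int[N]_z (dotprod (u z) (u z))%:E < +oo)%E by rewrite -riskE.
split.
  move=> i; rewrite riskE.
  have mcross := measurable_cross mu_ is1.
  split; rewrite unlock.
    rewrite -[RHS](integral_cross mu_ is1 s0 fisher_finite u2).
    apply: (integral_replace (P theta) Q i
      (h := fun q => (dotprod (u q.1) (s q.2))%:E)).
    exact/measurable_EFinP.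
  apply: le_trans (integral_norm_cross_le mu_ is1 fisher_finite u2).
  rewrite le_eqVlt; apply/orP; left; apply/eqP.
  apply: (integral_replace (P theta) Q i
    (h := fun q => `|dotprod (u q.1) (s q.2)|%:E)).
  by apply/measurable_EFinP; exact: measurableT_comp mcross.
move=> supp M1 dom thetaI.
have iM t j : Theta t -> (iid_law (P t) n \x Q)%E.-integrable setT
    (EFin \o (fun p => M p.1 p.2 ord0 j)).
  move=> /(M1 t j); rewrite unlock => ?; apply/integrableP; split => //.
  exact/measurable_EFinP.
have joint_derivable j t (x : n.-tuple X) : Theta t ->
    derivable (joint_density f ^~ x) t (delta_mx ord0 j).
  by move=> /(dom j t)[+ _]; exact.
pose m j (x : n.-tuple X) := Rintegral Q setT (fun w => M x w ord0 j).
pose mean j t := fine ('E_(iid_law (P t) n \x Q)[fun p => M p.1 p.2 ord0 j])%E.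
have der j : derivable (mean j) theta (delta_mx ord0 j) /\
    partial j (mean j) theta = Rintegral (power_measure mu n) setT
      (fun x => m j x * partial j (joint_density f ^~ x) theta).
  have [_ [U [G [nU iG GP]]]] := dom j _ theta_in.
  have -> : mean j = fun t =>
      fine (\int[iid_law (P t) n \x Q]_p (M p.1 p.2 ord0 j)%:E)%E.
    by apply/funext => t; rewrite /mean unlock.
  exact: (derive_mean f_density (Y := fun p => M p.1 p.2 ord0 j)
    (fun t => iM t j) (joint_derivable j) thetaI nU iG GP).
split; first by move=> j; exact: (der j).1.
have ms j : measurable_fun setT (fun x => s x ord0 j).
  by have /measurable_EFinP := measurable_int _ (is1 j).
pose sx j i (z : n.-tuple X * W) : R := s (tnth z.1 i) ord0 j.
have mtn i : measurable_fun [set: n.-tuple X * W] (fun z => tnth z.1 i).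
  exact: ((measurable_fun_tnthP _).1 measurable_fst i).
have msx j i : measurable_fun [set: n.-tuple X * W] (sx j i).
  exact: measurableT_comp (ms j) (mtn i).
have lawE i (h : X -> \bar R) : measurable_fun setT h ->
    (\int[N]_z h (tnth z.1 i) = \int[P theta]_x h x)%E.
  move=> mh; rewrite -(integral_tnth (P theta) i mh).
  have mhi : measurable_fun [set: n.-tuple X] (fun x : n.-tuple X => h (tnth x i)).
    exact: measurableT_comp mh (@measurable_tnth _ _ n i).
  exact: (integral_fst (iid_law (P theta) n) Q mhi).
have sx2 j i : (\int[N]_z ((sx j i z) ^+ 2)%:E < +oo)%E.
  rewrite (lawE i (fun x => (s x ord0 j ^+ 2)%:E)); last first.
    by apply/measurable_EFinP; exact: measurable_funX.
  have /integrableP[_] := fisher_finite j j.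
  by under eq_integral do rewrite gee0_abs ?lee_fin -?expr2 ?sqr_ge0//.
have isx j i : N.-integrable setT (EFin \o sx j i).
  exact: integrable_of_sqr (msx j i) (sx2 j i).
have sx0 j i : (\int[N]_z (sx j i z)%:E = 0)%E.
  by rewrite (lawE i (fun x => (s x ord0 j)%:E))//; exact/measurable_EFinP.
have uj2 j : (\int[N]_z ((u z ord0 j) ^+ 2)%:E < +oo)%E.
  apply: le_lt_trans u2; apply: ge0_le_integral => //.
  - by move=> z _; rewrite lee_fin sqr_ge0.
  - by apply/measurable_EFinP; exact: measurable_funX.
  - by apply/measurable_EFinP; exact: measurable_norm_sqr mu_.
  - move=> z _; rewrite lee_fin /dotprod (bigD1 j)//= -expr2 lerDl sumr_ge0// => k _.
    by rewrite -expr2 sqr_ge0.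
have iusx j i : N.-integrable setT (EFin \o (fun z => u z ord0 j * sx j i z)).
  exact: integrable_mul_of_sqr (mu_ j) (msx j i) (uj2 j) (sx2 j i).
pose T j (x : n.-tuple X) : R := \sum_i s (tnth x i) ord0 j.
have iT j : N.-integrable setT (EFin \o (fun z => T j z.1)).
  have -> : EFin \o (fun z : n.-tuple X * W => T j z.1) =
      (fun z => \sum_i (EFin \o sx j i) z)%E.
    by apply/funext => z; rewrite /T /= -sumEFin.
  exact: integrable_sum.
have T0 j : (\int[N]_z (T j z.1)%:E = 0)%E.
  under eq_integral do rewrite /T -sumEFin.
  by rewrite (integral_sum measurableT (isx j)) big1 => // i _; exact: sx0.
have iuT j : N.-integrable setT (EFin \o (fun z => u z ord0 j * T j z.1)).
  have -> : EFin \o (fun z : n.-tuple X * W => u z ord0 j * T j z.1) =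
      (fun z => \sum_i (EFin \o (fun z => u z ord0 j * sx j i z)%R) z)%E.
    by apply/funext => z; rewrite /T /= mulr_sumr -sumEFin.
  exact: integrable_sum.
have mT j : measurable_fun setT (T j).
  apply: measurable_sum => i.
  exact: measurableT_comp (ms j) (@measurable_tnth _ _ n i).
have iTM j : N.-integrable setT (EFin \o (fun z => T j z.1 * M z.1 z.2 ord0 j)).
  have -> : EFin \o (fun z : n.-tuple X * W => T j z.1 * M z.1 z.2 ord0 j) =
      (fun z => (EFin \o (fun z => u z ord0 j * T j z.1)%R) z +
        (theta ord0 j)%:E * (EFin \o (fun z => T j z.1)) z)%E.
    apply/funext => z; rewrite /= -EFinM -EFinD /u !mxE; congr EFin; ring.
  by apply: integrableD => //; exact: integrableZl.
(* The term with [theta] drops out since [T j] is centred; the rest is the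
   integral of the estimator against the derivative of the joint density. *)
have uTE j : (\int[N]_z (u z ord0 j * T j z.1)%:E =
    (partial j (mean j) theta)%:E)%E.
  transitivity (\int[N]_z (T j z.1 * M z.1 z.2 ord0 j)%:E)%E.
    transitivity (\int[N]_z ((T j z.1 * M z.1 z.2 ord0 j)%:E +
        (- theta ord0 j)%:E * (T j z.1)%:E))%E.
      apply: eq_integral => z _.
      by rewrite -EFinM -EFinD /u !mxE; congr EFin; ring.
    rewrite (integralD measurableT (iTM j)); last first.
      by apply: integrableZl => //; exact: iT.
    by rewrite (integralZl measurableT (iT j)) T0 mule0 adde0.
  have [i E] := integral_estimator_density (f_density theta theta_in) (mT j)
    (iM theta j theta_in) (iTM j).
  have pE : (fun x => T j x * m j x * \prod_(i < n) f theta (tnth x i)) =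
      (fun x => m j x * partial j (joint_density f ^~ x) theta).
    apply/funext => x.
    rewrite (@partial_joint_density_score _ _ _ _ f Theta)//.
    - by rewrite /T /joint_density; ring.
    - by move=> t y /f_density[].
  rewrite E (der j).2 /Rintegral fineK.
    by apply: eq_integral => x _; rewrite -[in RHS]/(m j x) -(congr1 (@^~ x) pE).
  have im : (power_measure mu n).-integrable setT
      (EFin \o (fun x => m j x * partial j (joint_density f ^~ x) theta)).
    by rewrite -pE.
  exact: (integrable_fin_num measurableT im).
transitivity (\sum_(i < n) \int[N]_z (\sum_j u z ord0 j * sx j i z)%:E)%E.
  by apply: eq_bigr => i _; rewrite unlock.
transitivity (\sum_j \int[N]_z (u z ord0 j * T j z.1)%:E)%E; last first.
  by rewrite -sumEFin; apply: eq_bigr => j _; exact: uTE.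
rewrite -(integral_sum measurableT iuT) -integral_sum//; last first.
  move=> i; under eq_fun do rewrite -sumEFin.
  by apply: integrable_sum => // j _; exact: iusx.
apply: eq_integral => z _.
rewrite !sumEFin; congr EFin; rewrite exchange_big /=.
by apply: eq_bigr => j _; rewrite /T mulr_sumr.
Qed.
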